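(* Let $(\Omega,\{\Xi_x\},E)$ and $(\Delta,\{\Lambda_y\},F)$ be continuous fields of Banach spaces over locally compact Hausdorff spaces $\Omega$ and $\Delta$ respectively. Let $\theta:E\to F$ be a bijective linear map such that both $\theta$ and its inverse $\theta^{-1}$ are separating. Then there are a homeomorphism $\sigma:\Delta\to\Omega$ and, for each $\nu\in\Delta$, a bijective linear operator $H_\nu:\Xi_{\sigma(\nu)}\to\Lambda_\nu$ such that $$\theta(f)(\nu)=H_\nu(f(\sigma(\nu)))\qquad(f\in E,\ \nu\in\Delta).$$ Moreover, at most finitely many $H_\nu$ are unbounded, and this can happen only when $\nu$ is an isolated point in $\Delta$. In particular, if $\Omega$ (or $\Delta$) contains no isolated point, then $\theta$ is automatically bounded.
   Context: A continuous field of Banach spaces $(\Omega,\{\Xi_x\},E)$ (in the sense of Dixmier and Fell) consists of a nonzero Banach space $\Xi_x$ for each $x\in\Omega$ and a linear space $E$ of vector fields $f\in\prod_{x\in\Omega}\Xi_x$ such that: (i) $x\mapsto\|f(x)\|$ is continuous and vanishes at infinity for every $f\in E$; (ii) $\{f(x):f\in E\}=\Xi_x$ for every $x\in\Omega$; (iii) any vector field $f$ whose norm function vanishes at infinity and which can be approximated locally uniformly (i.e. for each $x_0\in\Omega$ and $\epsilon>0$ there is $g\in E$ with $\|f(x)-g(x)\|<\epsilon$ for all $x$ in some neighbourhood of $x_0$) belongs to $E$. With the sup norm $\|f\|=\sup_x\|f(x)\|$ and pointwise multiplication, $E$ is then a full essential Banach $C_0(\Omega)$-normed module. A linear map $\theta:E\to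 F$ is separating if $\|\theta(e)(y)\|\,\|\theta(g)(y)\|=0$ for all $y\in\Delta$ whenever $e,g\in E$ satisfy $\|e(x)\|\,\|g(x)\|=0$ for all $x\in\Omega$; similarly for $\theta^{-1}$. *)

(* Defs.v *)
From HB Require Import structures.
From mathcomp Require Import all_boot all_order all_algebra.
From mathcomp Require Import all_classical all_reals all_analysis.
From mathcomp Require Import complex.

Set Implicit Arguments.
Unset Strict Implicit.
Unset Printing Implicit Defensive.

Import Order.TTheory GRing.Theory Num.Theory.
Import numFieldNormedType.Exports.

Local Open Scope classical_set_scope.
Local Open Scope ring_scope.

(* Banach spaces are real or complex.  In both cases a
   [completeNormedModType K] has its norm in the nonnegative part of [K]. *)
Inductive real_or_complex : numFieldType -> Prop :=
| RealScalars (R : realType) : real_or_complex R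
| ComplexScalars (R : realType) : real_or_complex R[i].

Definition vector_field (I : Type) (K : numFieldType)
  (V : I -> completeNormedModType K) := forall x : I, V x.

Section VectorFieldLmodule.
Variables (I : Type) (K : numFieldType) (V : I -> completeNormedModType K).
Local Notation VF := (vector_field V).

HB.instance Definition _ := gen_eqMixin VF.
HB.instance Definition _ := gen_choiceMixin VF.

Definition vf_zero : VF := fun x => 0.
Definition vf_opp (f : VF) : VF := fun x => - f x.
Definition vf_add (f g : VF) : VF := fun x => f x + g x.
Definition vf_scale (k : K) (f : VF) : VF := fun x => k *: f x.

Fact vf_addA : associative vf_add.
Proof. by move=> f g h; apply: functional_extensionality_dep => x; exact: addrA. Qed.

Fact vf_addC : commutative vf_add.
Proof. by move=> f g; apply: functional_extensionality_dep => x; exact: addrC. Qed.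

Fact vf_add0 : left_id vf_zero vf_add.
Proof. by move=> f; apply: functional_extensionality_dep => x; exact: add0r. Qed.

Fact vf_addN : left_inverse vf_zero vf_opp vf_add.
Proof. by move=> f; apply: functional_extensionality_dep => x; exact: addNr. Qed.

HB.instance Definition _ :=
  GRing.isZmodule.Build VF vf_addA vf_addC vf_add0 vf_addN.

Fact vf_scaleA a b (f : VF) : vf_scale a (vf_scale b f) = vf_scale (a * b) f.
Proof. by apply: functional_extensionality_dep => x; exact: scalerA. Qed.

Fact vf_scale1 : left_id 1 vf_scale.
Proof. by move=> f; apply: functional_extensionality_dep => x; exact: scale1r. Qed.

Fact vf_scaleDr : right_distributive vf_scale +%R.
Proof. by move=> a f g; apply: functional_extensionality_dep => x; exact: scalerDr. Qed.

Fact vf_scaleDl (f : VF) : {morph vf_scale^~ f : a b / a + b}.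
Proof. by move=> a b; apply: functional_extensionality_dep => x; exact: scalerDl. Qed.

HB.instance Definition _ := GRing.Zmodule_isLmodule.Build K VF
  vf_scaleA vf_scale1 vf_scaleDr vf_scaleDl.

End VectorFieldLmodule.

Definition vanishes_at_infinity (T : topologicalType) (K : numFieldType)
    (g : T -> K) : Prop :=
  forall eps : K, 0 < eps ->
    exists2 C : set T, compact C & forall x, ~ C x -> `|g x| < eps.

Definition locally_unif_approx (T : topologicalType) (K : numFieldType)
    (V : T -> completeNormedModType K) (E : {pred vector_field V})
    (f : vector_field V) : Prop :=
  forall (x0 : T) (eps : K), 0 < eps ->
    exists2 g : vector_field V, g \in E & \forall x \near x0, `|f x - g x| < eps.

Record continuous_field (K : numFieldType) (T : topologicalType) :=
  ContinuousField {
  fiber : T -> completeNormedModType K;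
  sections : submodClosed (vector_field fiber);
  fiber_nonzero : forall x, exists v : fiber x, v != 0;
  norm_section_continuous : forall f, f \in sections ->
    continuous (fun x => `|f x| : K);
  norm_section_vanishes : forall f, f \in sections ->
    vanishes_at_infinity (fun x => `|f x|);
  sections_full : forall x (v : fiber x),
    exists2 f : vector_field fiber, f \in sections & f x = v;
  sections_closed : forall f : vector_field fiber,
    vanishes_at_infinity (fun x => `|f x|) ->
    locally_unif_approx sections f -> f \in sections
}.

Section SectionSpace.
Variables (K : numFieldType) (T : topologicalType) (E : continuous_field K T).

Record section_space := Section {
  section_val : vector_field (fiber E);
  section_valP : section_val \in sections E
}.

Definition section_at (f : section_space) : forall x, fiber E x :=
  section_val f.
Coercion section_at : section_space >-> Funclass.

HB.instance Definition _ := [isSub for section_val].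
HB.instance Definition _ := [Choice of section_space by <:].
HB.instance Definition _ := [SubChoice_isSubLmodule of section_space by <:].

(* [supremum] is the least upper bound for the (partial) order of [K]; the
   values are real, so for complex [K] it is the usual real supremum.  It is 0
   if [T] is empty. *)
Definition sup_norm (f : section_space) : K :=
  supremum 0 (range (fun x => `|f x|)).

End SectionSpace.

Definition separating (K : numFieldType) (T S : topologicalType)
    (E : continuous_field K T) (F : continuous_field K S)
    (theta : section_space E -> section_space F) : Prop :=
  forall e g : section_space E, (forall x, `|e x| * `|g x| = 0) ->
    forall y, `|theta e y| * `|theta g y| = 0.

Definition bounded_wrt (K : numFieldType) (V W : Type)
    (normV : V -> K) (normW : W -> K) (f : V -> W) : Prop :=
  exists M : K, forall v, normW (f v) <= M * normV v.

Definition bounded_operator (K : numFieldType) (V W : normedModType K)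
    (f : V -> W) : Prop :=
  bounded_wrt (fun v : V => `|v|) (fun w : W => `|w|) f.

Definition homeomorphism (S T : topologicalType) (sigma : S -> T) : Prop :=
  continuous sigma /\
  exists tau : T -> S,
    [/\ cancel sigma tau, cancel tau sigma & continuous tau].

(* Main.v *)
Require Import Defs.
From HB Require Import structures.
From mathcomp Require Import all_boot all_order all_algebra.
From mathcomp Require Import all_classical all_reals all_analysis.
From mathcomp Require Import complex ring.

Set Implicit Arguments.
Unset Strict Implicit.
Unset Printing Implicit Defensive.

Import Order.TTheory GRing.Theory Num.Theory.
Import numFieldNormedType.Exports.

Local Open Scope classical_set_scope.
Local Open Scope ring_scope.

(** The heart of the matter is a support point for each [y]: a point [x] such
    that [theta f y] only depends on [f x].

    If [theta f y != 0], one may first truncate [f] so that it vanishes wherever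
    [|f|] is small.  For otherwise, cut [f] along the annuli
    [4^-n < |f| < 8 * 4^-n] and keep every other piece, to get a section [a] that
    is a sum of disjoint pieces [t_k] with [theta a y != 0] and
    [theta t_k y = 0] for all [k].  The section [sum_k 2^k t_k] also exists and
    its image is bounded, so only finitely many [theta t_k] meet the set where
    [|theta a|] exceeds a fixed positive bound, hence all of them vanish near
    [y].  A section with small support that is nonzero at [y] is then disjoint from every
    [theta t_k] without being disjoint from [theta a], contradicting that the
    inverse is separating.

    The truncated section has compact support.  If no point were a support point
    of [y], each [x] would have a section [f] with [f x = 0] and
    [theta f y != 0]; a cutoff function of [|f|] that vanishes near [x] does not
    change [theta _ y], and a finite product of such cutoffs kills the truncated
    section.

    The support maps of [theta] and of its inverse are inverse to each other, and
    a gliding hump argument bounds the fiber maps uniformly outside a finite set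
    of points. *)

(** * Real and complex scalars at once *)

(** Carries facts about the reals over to [K]: every norm in [K] is [j] of a real number, since a
    nonnegative complex number has imaginary part 0. *)
Lemma real_scalars (K : numFieldType) : real_or_complex K ->
  exists (R : realType) (j : {rmorphism R -> K}),
    (forall x, `|j x| = j `|x|) /\ (forall z : K, 0 <= z -> exists x, z = j x).
Proof.
case=> R.
  exists R, (@GRing.RMorphism.clone R R idfun _).
  by split=> // z _; exists z.
exists R, (@GRing.RMorphism.clone R R[i] (real_complex R) _).
split=> [x|[a b]]; last first.
  by rewrite lecE /= => /andP[/eqP -> _]; exists a.
by rewrite /= normc_def /= expr0n /= addr0 sqrtr_sqr.
Qed.

Section Scalars.
Variables (K : numFieldType) (K_scalars : real_or_complex K).

Lemma scalar_archimedean (z : K) : exists n, `|z| < n%:R.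
Proof.
have [R [j [jN jP]]] := real_scalars K_scalars.
have [x ->] := jP _ (normr_ge0 z).
exists (Num.bound `|x|); rewrite -(rmorph_nat j) -subr_gt0 -rmorphB /=.
have : 0 < (Num.bound `|x|)%:R - x.
  by rewrite subr_gt0 (le_lt_trans (ler_norm _))// archi_boundP.
move=> h; have jh : `|j ((Num.bound `|x|)%:R - x)| = j ((Num.bound `|x|)%:R - x).
  by rewrite jN ger0_norm ?ltW.
by rewrite -jh normr_gt0 fmorph_eq0 gt_eqF.
Qed.

Lemma exp_half_small (eps : K) : 0 < eps ->
  exists N, forall n, (N <= n)%N -> 2^-1 ^+ n < eps.
Proof.
move=> e0; have [N] := scalar_archimedean eps^-1.
rewrite ger0_norm ?invr_ge0 ?ltW// => hN; exists N => n Nn.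
rewrite exprVn invf_plt ?posrE ?exprn_gt0//.
apply: (lt_le_trans hN); rewrite -natrX ler_nat.
by apply: leq_trans Nn (ltnW _); apply: ltn_expl.
Qed.

(** Upper bounds of a nonempty set of nonnegative elements are nonnegative, so the set and its
    bounds lie in the range of [j] and the supremum can be formed in [R]. *)
Lemma scalar_supremums (A : set K) (M : K) : A !=set0 ->
  A `<=` [set z | 0 <= z] -> ubound A M -> supremums A !=set0.
Proof.
have [R [j [jN jP]]] := real_scalars K_scalars.
have jle (x y : R) : (j x <= j y) = (x <= y).
  rewrite -subr_ge0 -rmorphB -[RHS]subr_ge0; apply/idP/idP => [h|/ger0_norm h].
    by apply/normr_idP/(fmorph_inj j); rewrite -jN ger0_norm.
  by rewrite -h -jN.
move=> [a Aa] A0 AM; have [m Mm] := jP M (le_trans (A0 _ Aa) (AM _ Aa)).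
pose B : set R := [set x | A (j x)].
have [b ab] := jP _ (A0 _ Aa).
have hsB : has_sup B.
  split; first by exists b; rewrite /B/= -ab.
  by exists m => x /= Ax; rewrite -jle -Mm; exact: AM.
exists (j (sup B)); split=> [z Az|u Au].
  have [x zx] := jP _ (A0 _ Az); rewrite zx jle.
  by apply: ub_le_sup; [case: hsB | rewrite /B/= -zx].
have [v uv] := jP u (le_trans (A0 _ Aa) (Au _ Aa)).
rewrite uv jle; apply: ge_sup; first by case: hsB.
by move=> x /= Ax; rewrite -jle -uv; exact: Au.
Qed.

Lemma point_urysohn (T : topologicalType) : hausdorff_space T ->
  locally_compact [set: T] -> forall (x : T) (B : set T), closed B -> ~ B x ->
  exists phi : T -> K, [/\ continuous phi, phi x = 1,
    forall t, B t -> phi t = 0 & forall t, `|phi t| <= 1].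
Proof.
have [R [j [jN jP]]] := real_scalars K_scalars.
move=> hT lT x B cB Bx.
have us : uniform_separator [set x] B.
  exact: (@locally_compact_completely_regular T R).
have jle (a b : R) : a <= b -> j a <= j b.
  by move=> ab; rewrite -subr_ge0 -rmorphB -[b - a]ger0_norm ?subr_ge0// -jN.
have jlt (a b : R) : (j a < j b) -> a < b.
  by move=> ab; rewrite ltNge; apply: contraTN ab => /jle h; rewrite le_gtF.
exists (fun t => j (1 - @Urysohn T R [set x] B t)); split.
- move=> t; apply/cvgrPdist_lt => e e0.
  have [d de] := jP e (ltW e0).
  have d0 : 0 < d by apply: jlt; rewrite rmorph0 -de.
  have /cvgrPdist_lt /(_ d d0) := @Urysohn_continuous T R [set x] B t.
  apply: filterS => s h; rewrite -rmorphB jN de.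
  have -> : 1 - @Urysohn T R [set x] B t - (1 - Urysohn [set x] B s)
     = Urysohn [set x] B s - Urysohn [set x] B t.
    by rewrite opprB addrC addrA subrK.
  rewrite distrC lt_neqAle jle ?ltW// andbT (inj_eq (fmorph_inj j)).
  by rewrite lt_eqF.
- have := @Urysohn_sub0 T R [set x] B us => /(_ (Urysohn [set x] B x)) h.
  by rewrite h ?subr0 ?rmorph1//; exists x.
- move=> t Bt; have := @Urysohn_sub1 T R [set x] B us => /(_ (Urysohn [set x] B t)) h.
  by rewrite h ?subrr ?rmorph0//; exists t.
- move=> t; rewrite jN -(rmorph1 j) jle//.
  have := @Urysohn_range T R [set x] B (Urysohn [set x] B t).
  case/(_ (ex_intro2 _ _ t I erefl))/andP => h0 h1.
  by rewrite ger0_norm ?subr_ge0// gerBl.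
Qed.

End Scalars.

(** * Induction over compact sets, and cutoffs *)

(** If [Q C] failed, the sets [A] such that [Q] holds for [C] minus [A] would form a proper filter
    containing [C]. A cluster point in [C] has a neighbourhood [U] with [Q U], but the complement of
    [U] is in the filter. *)
Lemma compact_ind (T : topologicalType) (C : set T) (Q : set T -> Prop) :
  compact C -> Q set0 -> (forall A B, A `<=` B -> Q B -> Q A) ->
  (forall A B, Q A -> Q B -> Q (A `|` B)) ->
  (forall x, C x -> exists2 U, nbhs x U & Q U) -> Q C.
Proof.
move=> cC Q0 QS QU QC; apply: contrapT => nQ.
pose F : set_system T := fun A => Q (C `\` A).
have FF : ProperFilter F.
  split; first by rewrite /F setD0.
  split; first by rewrite /F setDT.
  - by move=> A B FA FB; rewrite /F setDIr; exact: QU.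
  - by move=> A B AB; apply: QS; exact: setDS.
have FC : F C by rewrite /F setDv.
have [p [Cp clp]] := cC F FF FC.
have [U pU QU'] := QC p Cp.
have : F (~` U) by apply: QS QU'; rewrite setDE setCK; exact: subIsetr.
by move=> /clp /(_ pU)[q []].
Qed.

(* The identity on [0, 1] extended by constants.  It is written with norms
   because minima and maxima are not available in the complex case. *)
Definition clamp (K : numFieldType) (t : K) : K := (1 + `|t| - `|t - 1|) / 2.

Lemma clamp_eq0 (K : numFieldType) (t : K) : t <= 0 -> clamp t = 0.
Proof.
move=> t0; rewrite /clamp ler0_norm// ler0_norm ?subr_le0 ?(le_trans t0)//.
by field.
Qed.

Lemma clamp_eq1 (K : numFieldType) (t : K) : 1 <= t -> clamp t = 1.
Proof.
move=> t1; rewrite /clamp ger0_norm ?(le_trans _ t1)// ger0_norm ?subr_ge0//.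
by field.
Qed.

Lemma norm_clamp_le1 (K : numFieldType) (t : K) : t \is Num.real ->
  `|clamp t| <= 1.
Proof.
move=> tr; have [t0|/ltW t0] := real_leP tr (real0 K).
  by rewrite clamp_eq0 ?normr0.
have [t1|/ltW t1] := real_leP (real1 K) tr; first by rewrite clamp_eq1 ?normr1.
rewrite /clamp (ger0_norm t0) [`|t - 1|]ler0_norm ?subr_le0//.
have -> : (1 + t - - (t - 1)) / 2 = t by field.
by rewrite ger0_norm.
Qed.

Lemma continuous_clamp (K : numFieldType) (T : topologicalType) (u : T -> K) :
  continuous u -> continuous (fun x => clamp (u x)).
Proof.
move=> cu x; apply: cvgM; last exact: cvg_cst.
apply: cvgB; first by apply: cvgD; [exact: cvg_cst|exact: cvg_norm (cu x)].
by apply: cvg_norm; apply: cvgB; [exact: cu|exact: cvg_cst].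
Qed.

(** * Sections of a continuous field *)

Section Sections.
Variables (K : numFieldType) (T : topologicalType) (E : continuous_field K T).
Local Notation S := (section_space E).

Lemma section_ext (f g : S) : (forall x, f x = g x) -> f = g.
Proof. by move=> fg; apply/val_inj/functional_extensionality_dep. Qed.

Lemma sectionD (f g : S) x : (f + g) x = f x + g x. Proof. by []. Qed.
Lemma sectionB (f g : S) x : (f - g) x = f x - g x. Proof. by []. Qed.
Lemma sectionZ a (f : S) x : (a *: f) x = a *: f x. Proof. by []. Qed.
Lemma section0 x : (0 : S) x = 0. Proof. by []. Qed.
Lemma section_sum (I : Type) (r : seq I) (P : pred I) (g : I -> S) x :
  (\sum_(i <- r | P i) g i) x = \sum_(i <- r | P i) g i x.
Proof.
by elim/big_ind2: _ => // ? ? ? ? <- <-.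
Qed.

Lemma section_norm_continuous (f : S) : continuous (fun x => `|f x| : K).
Proof. exact: norm_section_continuous (section_valP f). Qed.

Lemma section_neq0_nbhs (f : S) x : f x != 0 -> \forall y \near x, f y != 0.
Proof.
move=> fx; have fx0 : 0 < `|f x| by rewrite normr_gt0.
have /cvgrPdist_lt /(_ _ fx0) := @section_norm_continuous f x.
apply: filterS => y; apply: contraTN => /eqP->.
by rewrite normr0 subr0 normr_id ltxx.
Qed.

(** Near [x0] the product is approximated by the section [phi x0 *: f], because [phi] is continuous
    and [|f| < |f x0| + 1] there. *)
Lemma section_scaleE (phi : T -> K) (f : S) : continuous phi ->
  (forall x, `|phi x| <= 1) -> exists g : S, forall x, g x = phi x *: f x.
Proof.
move=> cphi b1.
suff h : (fun x => phi x *: f x) \in sections E by exists (Section h).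
apply: sections_closed => [e e0|x0 e e0].
  have [C cC Ce] := norm_section_vanishes (section_valP f) e0.
  exists C => // x /Ce; rewrite !normr_id normrZ; apply: le_lt_trans.
  by rewrite ler_piMl.
exists (section_val (phi x0 *: f)); first exact: section_valP.
have d0 : 0 < e / (`|f x0| + 1) by rewrite divr_gt0// ltr_wpDl.
have /cvgrPdist_lt /(_ _ ltr01) f1 := @section_norm_continuous f x0.
have /cvgrPdist_lt /(_ _ d0) := cphi x0.
apply: filterS2 f1 => x fx px.
rewrite [section_val _ x]/= -scalerBl normrZ distrC.
have : `|f x| < `|f x0| + 1.
  rewrite addrC -ltrBlDr (le_lt_trans _ fx)// distrC real_ler_norm//.
have nz : `|f x0| + 1 != 0 by rewrite gt_eqF// ltr_wpDl.
by move=> h; rewrite -[ltRHS](divfK nz) ltr_pM.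
Qed.

Lemma section_bounded (K_scalars : real_or_complex K) (f : S) :
  exists n, forall x, `|f x| <= n%:R.
Proof.
have [C cC Cf] := norm_section_vanishes (section_valP f) ltr01.
pose Q (A : set T) := exists n, forall x, A x -> `|f x| <= n%:R.
have [n fn] : Q C.
  apply: compact_ind cC _ _ _ _.
  - by exists 0%N.
  - by move=> A B AB [n Bn]; exists n => x /AB /Bn.
  - move=> A B [m Am] [n Bn]; exists (m + n)%N => x [/Am h|/Bn h];
      by rewrite (le_trans h)// ler_nat ?leq_addl ?leq_addr.
  - move=> x _; have [n xn] := scalar_archimedean K_scalars (`|f x| + 1).
    exists [set y | `|f y| <= n%:R]; last by exists n.
    have /cvgrPdist_lt /(_ _ ltr01) := @section_norm_continuous f x.
    apply: filterS => y fy /=; rewrite ltW// (lt_trans _ xn)//.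
    rewrite [ltRHS]ger0_norm ?addr_ge0// addrC -ltrBlDr (le_lt_trans _ fy)//.
    by rewrite distrC real_ler_norm// realB.
exists n.+1 => x; have [/fn h|/Cf] := pselect (C x).
  by rewrite (le_trans h)// ler_nat.
by rewrite normr_id => h; rewrite ltW// (lt_le_trans h)// ler1n.
Qed.

(** The fibers are complete, so the series converges pointwise. The tail bound does not depend on
    [x], so the limit is a uniform limit of sections. *)
Lemma section_series (K_scalars : real_or_complex K) (g : nat -> S) (C : K) :
  (forall n x, `|g n x| <= C * 2^-1 ^+ n) ->
  exists w : S, forall x N,
    `|w x - (\sum_(n < N) g n) x| <= 2 * C * 2^-1 ^+ N.
Proof.
move=> gC.
(* The sign of [C] is only known once [T] has a point. *)
have C0 (x : T) : 0 <= C.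
  have := gC 0%N x; by rewrite expr0 mulr1; exact: le_trans.
have partial x N m : `|\sum_(N <= n < N + m) g n x| <= 2 * C * 2^-1 ^+ N.
  (* Adding the remaining geometric tail on the left makes the induction on [m] work. *)
  suff : `|\sum_(N <= n < N + m) g n x| + 2 * C * 2^-1 ^+ (N + m)
         <= 2 * C * 2^-1 ^+ N.
    by apply: le_trans; rewrite lerDl !mulr_ge0 ?C0 ?exprn_ge0 ?invr_ge0.
  elim: m => [|m IHm]; first by rewrite addn0 big_geq// normr0 add0r.
  rewrite addnS big_nat_recr ?leq_addr//= (le_trans _ IHm)//.
  have -> : 2 * C * 2^-1 ^+ (N + m) =
      C * 2^-1 ^+ (N + m) + 2 * C * 2^-1 ^+ (N + m).+1.
    by rewrite exprS; field.
  by rewrite addrA lerD2r (le_trans (ler_normD _ _))// lerD2l.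
have tail x N m : (N <= m)%N ->
    `|\sum_(n < m) g n x - \sum_(n < N) g n x| <= 2 * C * 2^-1 ^+ N.
  move=> Nm; rewrite -!(big_mkord xpredT (fun n => g n x)).
  by rewrite (@big_cat_nat _ _ _ N 0 m)//= addrAC subrr add0r -{1}(subnKC Nm).
have small (x : T) (e : K) : 0 < e ->
    exists N, forall n, (N <= n)%N -> 2 * C * 2^-1 ^+ n < e.
  move=> e0; have c0 : 0 < 2 * C + 1 by rewrite ltr_wpDl// mulr_ge0// (C0 x).
  have [N hN] := exp_half_small K_scalars (divr_gt0 e0 c0).
  exists N => n /hN; rewrite ltr_pdivlMr// => h; apply: le_lt_trans h.
  by rewrite mulrC ler_wpM2l ?exprn_ge0 ?invr_ge0// lerDl.
have cv x : cvgn (fun N => \sum_(n < N) g n x).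
  apply: cauchy_cvg; apply: cauchy_exP => e e0.
  have [N hN] := small x e e0.
  exists (\sum_(n < N) g n x); exists N => // m /= Nm.
  by rewrite -ball_normE /ball_/= distrC (le_lt_trans (tail x _ _ Nm))// hN.
pose w x := limn (fun N => \sum_(n < N) g n x).
have wP x N : `|w x - \sum_(n < N) g n x| <= 2 * C * 2^-1 ^+ N.
  have h : (fun m => `|\sum_(n < m) g n x - \sum_(n < N) g n x| : K) @ \oo
      --> `|w x - \sum_(n < N) g n x|.
    by apply: cvg_norm; apply: cvgB; [exact: cv|exact: cvg_cst].
  have br : 2 * C * 2^-1 ^+ N \is Num.real.
    by rewrite ger0_real// !mulr_ge0 ?C0 ?exprn_ge0 ?invr_ge0.
  rewrite real_leNgt//; apply/negP => lt_ba.
  have ab0 : 0 < `|w x - \sum_(n < N) g n x| - 2 * C * 2^-1 ^+ N.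
    by rewrite subr_gt0.
  move/cvgrPdist_lt: (cv x) => /(_ _ ab0) [M _ hM].
  have /= hw := hM (maxn M N) (leq_maxl _ _).
  have := ler_distD (\sum_(n < maxn M N) g n x) (w x) (\sum_(n < N) g n x).
  apply/negP; rewrite real_leNgt ?realD// negbK.
  by rewrite -[ltRHS](subrK (2 * C * 2^-1 ^+ N)) ltr_leD// tail// leq_maxr.
suff wE : w \in sections E.
  by exists (Section wE) => x N; rewrite section_sum; exact: wP.
apply: sections_closed => [e e0|x0 e e0].
  have e20 : 0 < e / 2 by rewrite divr_gt0.
  have [N hN] : exists N, forall x : T, 2 * C * 2^-1 ^+ N < e / 2.
    have [[x _]|nT] := pselect ([set: T] !=set0).
      by have [N hN] := small x _ e20; exists N => _; exact: hN.
    by exists 0%N => x; case: nT; exists x.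
  have [D cD De] := norm_section_vanishes (section_valP (\sum_(n < N) g n)) e20.
  exists D => // x /De; rewrite !normr_id -[section_val _]/(section_at _).
  rewrite section_sum => h; rewrite -[w x](subrK (\sum_(n < N) g n x)).
  rewrite (le_lt_trans (ler_normD _ _))// (_ : e = e / 2 + e / 2); last by field.
  rewrite ltrD//.
  exact: le_lt_trans (wP _ _) (hN x).
have [N hN] := small x0 e e0.
exists (section_val (\sum_(n < N) g n)); first exact: section_valP.
near=> x; rewrite -[section_val _]/(section_at _) section_sum.
by rewrite (le_lt_trans (wP _ _))// hN.
Unshelve. all: end_near.
Qed.

(** Serves to evaluate a series of sections at a point where its partial sums are eventually
    constant. *)
Lemma eq_of_dist_exp_half (K_scalars : real_or_complex K) x
    (v w : fiber E x) (C : K) (N0 : nat) :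
  (forall N, (N0 <= N)%N -> `|v - w| <= C * 2^-1 ^+ N) -> v = w.
Proof.
move=> vw; apply/eqP; rewrite -subr_eq0 -normr_eq0; apply/negPn/negP => ne0.
have d0 : 0 < `|v - w| by rewrite lt_neqAle eq_sym ne0 normr_ge0.
have C0 : 0 < C.
  have := lt_le_trans d0 (vw N0 (leqnn _)).
  by rewrite pmulr_lgt0// exprn_gt0// invr_gt0.
have [N hN] := exp_half_small K_scalars (divr_gt0 d0 C0).
have := hN (maxn N0 N) (leq_maxr _ _); rewrite ltr_pdivlMr// mulrC => h.
by have := le_lt_trans (vw _ (leq_maxl N0 N)) h; rewrite ltxx.
Qed.

Lemma section_localize (K_scalars : real_or_complex K)
    (hT : hausdorff_space T) (lT : locally_compact [set: T])
    (f : S) x (U : set T) : nbhs x U ->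
  exists g : S, [/\ g x = f x, forall t, ~ U t -> g t = 0 &
                    forall t, `|g t| <= `|f t|].
Proof.
move=> xU; have cB : closed (~` U°) by apply: open_closedC; exact: open_interior.
have [|phi [cphi phi1 phi0 phib]] := point_urysohn K_scalars hT lT cB (x := x).
  by apply; exact: xU.
have [g gE] := section_scaleE f cphi phib.
exists g; split=> [|t Ut|t]; first by rewrite gE phi1 scale1r.
- by rewrite gE phi0 ?scale0r// => /interior_subset.
- by rewrite gE normrZ ler_piMl.
Qed.

End Sections.

(** * Support points of a separating bijection *)

Section Separating.
Variables (K : numFieldType) (K_scalars : real_or_complex K).
Variables (Omega Delta : topologicalType).
Hypothesis Delta_hausdorff : hausdorff_space Delta.
Hypothesis Delta_lc : locally_compact [set: Delta].
Variables (E : continuous_field K Omega) (F : continuous_field K Delta).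
Variables (theta : {linear section_space E -> section_space F}).
Variables (theta_inv : section_space F -> section_space E).
Hypotheses (thetaK : cancel theta theta_inv) (theta_invK : cancel theta_inv theta).
Hypotheses (theta_sep : separating theta) (theta_inv_sep : separating theta_inv).

Lemma separating_eq0 (e g : section_space E) y :
  (forall x, e x != 0 -> g x = 0) -> theta g y != 0 -> theta e y = 0.
Proof.
move=> eg gy; have /eqP : `|theta e y| * `|theta g y| = 0.
  apply: theta_sep => x.
  by have [->|/eg ->] := eqVneq (e x) 0; rewrite normr0 ?mulr0 ?mul0r.
by rewrite mulf_eq0 !normr_eq0 (negPf gy) orbF => /eqP.
Qed.

(** The hypotheses are what is used of [a] being a disjoint sum of the [t k], and [a'] of the
    [2 ^+ k *: t k], stated pointwise so that no convergence enters. *)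
Lemma separating_disjoint_sum (t : nat -> section_space E)
    (a a' : section_space E) y :
  (forall k x, t k x != 0 -> a x = t k x) ->
  (forall k x, t k x != 0 -> a' x = 2 ^+ k *: t k x) ->
  (forall x, a x != 0 -> exists k, t k x != 0) ->
  theta a y != 0 -> exists k, theta (t k) y != 0.
Proof.
move=> ta ta' at_ ay; apply: contrapT => nt.
have ty k : theta (t k) y = 0.
  by apply/eqP/negPn/negP => h; apply: nt; exists k.
(* [t k] is disjoint from [a - t k] and from [a' - 2 ^+ k *: t k], so the images of these
   differences vanish wherever [theta (t k)] does not. *)
have key k z : theta (t k) z != 0 ->
    theta a z = theta (t k) z /\ theta a' z = 2 ^+ k *: theta (t k) z.
  move=> tz; split; apply/eqP; rewrite -subr_eq0.
    rewrite -sectionB -linearB; apply/eqP/(separating_eq0 _ tz) => x.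
    by apply: contraNeq => /ta h; rewrite sectionB h subrr.
  rewrite -sectionZ -linearZ -sectionB -linearB.
  apply/eqP/(separating_eq0 _ tz) => x.
  by apply: contraNeq => /ta' h; rewrite sectionB sectionZ h subrr.
have [n bn] := section_bounded K_scalars (theta a').
pose d := `|theta a y| / 2.
have d0 : 0 < d by rewrite divr_gt0// normr_gt0.
(* For [k >= k0] one has [2 ^+ k * d > n.+1]. Where [|theta a| > d], a nonzero [theta (t k)] would
   then push [|theta a'|] above its bound [n]. *)
have [k0 hk0] := exp_half_small K_scalars (divr_gt0 d0 (ltr0Sn K n)).
have W1 : \forall z \near y, d < `|theta a z|.
  have /cvgrPdist_lt /(_ _ d0) := @section_norm_continuous _ _ F (theta a) y.
  apply: filterS => z h.
  have dE : d = `|theta a y| - d by rewrite /d; field.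
  by rewrite dE ltrBlDr -ltrBlDl (le_lt_trans _ h)// real_ler_norm.
(* For the finitely many [k < k0], [theta (a - t k)] equals [theta a] at [y], so it stays nonzero
   nearby; by [key], [theta (t k)] vanishes there. *)
have W2 : \forall z \near y, forall k : 'I_k0, theta (a - t k) z != 0.
  apply: filter_forall => k; apply: section_neq0_nbhs.
  by rewrite linearB sectionB ty subr0.
have W : \forall z \near y, forall k, theta (t k) z = 0.
  apply: filterS2 W1 W2 => z h1 h2 k; apply/eqP/negPn/negP => tz.
  have [lk|lk] := ltnP k k0.
    have := h2 (Ordinal lk) => /=; rewrite linearB sectionB.
    by have [-> _] := key _ _ tz; rewrite subrr eqxx.
  have [e1 e2] := key _ _ tz; have := bn z.
  rewrite e2 -e1 normrZ ger0_norm ?exprn_ge0// => h.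
  have := hk0 _ lk; rewrite exprVn ltr_pdivlMr// ltr_pdivrMl ?exprn_gt0// => h3.
  have dh : 2 ^+ k * d <= 2 ^+ k * `|theta a z| by rewrite ler_wpM2l ?ltW.
  by have := lt_le_trans h3 (le_trans dh h); rewrite ltr_nat ltnNge leqnSn.
(* [g] equals [theta a] at [y] and lives where all [theta (t k)] vanish. Hence [theta_inv g] is
   disjoint from every [t k], so from [a], and this forces [g y = 0]. *)
have [g [gy gW _]] :=
  section_localize K_scalars Delta_hausdorff Delta_lc (theta a) W.
have gt k x : theta_inv g x != 0 -> t k x = 0.
  move=> gx.
  have /eqP : `|theta_inv g x| * `|theta_inv (theta (t k)) x| = 0.
    apply: theta_inv_sep => z.
    have [/(_ k) ->|/gW ->] := pselect (forall k, theta (t k) z = 0);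
    by rewrite normr0 ?mulr0 ?mul0r.
  by rewrite thetaK mulf_eq0 !normr_eq0 (negPf gx) => /eqP.
have := @separating_eq0 (theta_inv g) a y; rewrite theta_invK gy => h.
move: (ay); rewrite h ?eqxx// => x gx; apply/eqP/negPn/negP => /at_[k].
by rewrite (gt _ _ gx) eqxx.
Qed.

(** Neighbouring annuli overlap but those two apart do not, so the pieces of odd and of even index
    form two disjoint families. Their sums add up to [f], so one of the sums has nonzero image at
    [y]. *)
Lemma separating_truncate (f : section_space E) y : theta f y != 0 ->
  exists (r : K) (h : section_space E),
    [/\ 0 < r, forall x, `|f x| <= r -> h x = 0 & theta h y != 0].
Proof.
move=> fy.
have real_scaled n x : 4 ^+ n * `|f x| \is Num.real.
  by rewrite ger0_real ?mulr_ge0 ?exprn_ge0.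
have /choice[S SE] : forall n, exists S : section_space E,
    forall x, S x = clamp (4 ^+ n * `|f x| - 1) *: f x.
  move=> n; apply: section_scaleE.
    apply: continuous_clamp => x; apply: cvgB; last exact: cvg_cst.
    by apply: cvgM; [exact: cvg_cst|exact: section_norm_continuous].
  by move=> x; rewrite norm_clamp_le1// realB.
have S0 n x : 4 ^+ n * `|f x| <= 1 -> S n x = 0.
  by move=> h; rewrite SE clamp_eq0 ?scale0r// subr_le0.
have S1 n x : 2 <= 4 ^+ n * `|f x| -> S n x = f x.
  by move=> h; rewrite SE clamp_eq1 ?scale1r// lerBrDr.
have Sle n x : `|S n x| <= `|f x|.
  by rewrite SE normrZ ler_piMl// norm_clamp_le1// realB.
pose t n := if n is m.+1 then S m.+1 - S m else S 0%N.
have tsum N : \sum_(n < N.+1) t n = S N.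
  by elim: N => [|N IHN]; rewrite big_ord_recr/= ?big_ord0 ?add0r// IHN addrC subrK.
have t_small n x : 4 ^+ n * `|f x| <= 1 -> t n x = 0.
  case: n => [|n] h; first exact: S0.
  rewrite /t sectionB !S0 ?subrr// (le_trans _ h)// ler_wpM2r//.
  by rewrite exprS ler_peMl ?exprn_ge0// ler1n.
have t_large n x : 2 <= 4 ^+ n * `|f x| -> t n.+1 x = 0.
  move=> h; rewrite /t sectionB !S1 ?subrr// (le_trans h)// ler_wpM2r//.
  by rewrite exprS ler_peMl ?exprn_ge0// ler1n.
have [M fM] := section_bounded K_scalars f.
(* [M] bounds the piece of index 0. Where [t n.+1] is nonzero, [4 ^+ n * |f| < 2], so
   [|S n.+1| + |S n|] is at most [4 / 4 ^+ n = 16 / 4 ^+ n.+1]. *)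
pose C : K := M%:R + 16.
have tC n x : `|t n x| <= C * 4^-1 ^+ n.
  case: n => [|n].
    by rewrite expr0 mulr1 (le_trans (Sle _ _))// (le_trans (fM _))// lerDl.
  have [/t_large ->|h] := real_leP (ger0_real (ler0n K 2)) (real_scaled n x).
    by rewrite normr0 mulr_ge0 ?addr_ge0 ?exprn_ge0 ?invr_ge0.
  rewrite (le_trans (ler_normB _ _))// (le_trans (lerD (Sle _ _) (Sle _ _)))//.
  rewrite (@le_trans _ _ (16 * 4^-1 ^+ n.+1))//; last first.
    by rewrite ler_wpM2r ?exprn_ge0 ?invr_ge0// lerDr.
  have -> : (16 * 4^-1 ^+ n.+1 : K) = (2 + 2) * (4 ^+ n)^-1.
    by rewrite exprS exprVn; field; rewrite expf_neq0.
  rewrite mulrDl; apply: lerD; rewrite ler_pdivlMr ?exprn_gt0//;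
  by rewrite mulrC ltW.
have tt m n x : (m < n)%N -> t m x != 0 -> t n x != 0 -> n = m.+1.
  move=> mn tm tn; apply/eqP; rewrite eqn_leq mn andbT leqNgt; apply/negP => mn2.
  case: n mn tn mn2 => // n mn tn mn2.
  move/negP: tn; apply; apply/eqP/t_large.
  have [/t_small tm0|fm] := real_leP (real_scaled m x) (real1 K).
    by rewrite tm0 eqxx in tm.
  rewrite (@le_trans _ _ (4 ^+ m.+1 * `|f x|))//.
    by rewrite exprS -mulrA (@le_trans _ _ (4 * 1)) ?ler_wpM2l ?mulr1 ?ler_nat ?ltW.
  by rewrite ler_wpM2r// ler_weXn2l// ler1n.
pose T (p : bool) n := if odd n == p then t n else 0.
have T_uniq p j k x : T p j x != 0 -> T p k x != 0 -> j = k.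
  rewrite /T; case: ifP => [/eqP jp|_]; last by rewrite section0 eqxx.
  case: ifP => [/eqP kp tj tk|_ _]; last by rewrite section0 eqxx.
  have [jk|kj|//] := ltngtP j k.
    by move: kp; rewrite (tt _ _ _ jk tj tk) /= jp; case: p {jp}.
  by move: jp; rewrite (tt _ _ _ kj tk tj) /= kp; case: p {kp}.
(* The pieces decay like [4^-1 ^+ n], which leaves room for the weights [2 ^+ n]. *)
have TC p n x : `|(2 ^+ n *: T p n) x| <= C * 2^-1 ^+ n.
  have -> : C * 2^-1 ^+ n = 2 ^+ n * (C * 4^-1 ^+ n).
    rewrite mulrCA; congr (_ * _); rewrite !exprVn.
    have -> : (4 : K) = 2 * 2 by rewrite -natrM.
    by rewrite exprMn invfM mulrA divff ?mul1r// expf_neq0.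
  rewrite sectionZ normrZ ger0_norm ?exprn_ge0// ler_wpM2l ?exprn_ge0//.
  rewrite /T; case: ifP => _; first exact: tC.
  by rewrite section0 normr0 mulr_ge0 ?addr_ge0 ?exprn_ge0 ?invr_ge0.
have TC1 p n x : `|T p n x| <= C * 2^-1 ^+ n.
  rewrite (le_trans _ (TC p n x))// sectionZ normrZ ler_peMl// ger0_norm ?exprn_ge0//.
  by rewrite exprn_ege1 ?ler1n.
have /choice[a aP] := fun p => section_series K_scalars (TC1 p).
have /choice[a' aP'] := fun p => section_series K_scalars (TC p).
have aE p x v N0 : (forall N, (N0 <= N)%N -> (\sum_(n < N) T p n) x = v) ->
    a p x = v.
  move=> h; apply: (eq_of_dist_exp_half K_scalars (N0 := N0)) => N /h <-.
  exact: aP.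
have aE' p x v N0 :
    (forall N, (N0 <= N)%N -> (\sum_(n < N) 2 ^+ n *: T p n) x = v) ->
    a' p x = v.
  move=> h; apply: (eq_of_dist_exp_half K_scalars (N0 := N0)) => N /h <-.
  exact: aP'.
have T_other p k x n : T p k x != 0 -> n != k -> T p n x = 0.
  by move=> Tk; apply: contraNeq => /(@T_uniq _ _ k) ->.
have fE : f = a true + a false.
  apply: section_ext => x.
  have [N0 hN0] : exists N0, forall n, (N0 <= n)%N -> S n x = f x.
    have [fx|fx] := eqVneq (f x) 0.
      by exists 0%N => n _; rewrite SE fx scaler0.
    have fx0 : 0 < `|f x| / 2 by rewrite divr_gt0// normr_gt0.
    have [N0 hN0] := exp_half_small K_scalars fx0.
    exists N0 => n /hN0 h; apply: S1; move: h.
    rewrite ltr_pdivlMr// exprVn ltr_pdivrMl ?exprn_gt0// => /ltW h.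
    by rewrite (le_trans h)// ler_wpM2r// lerXn2r ?nnegrE ?ler_nat.
  (* Each of the two series contributes an error [2 * C]. The shift to [N0.+1] is there because
     [S N] is the sum of [N.+1] pieces. *)
  apply: (eq_of_dist_exp_half K_scalars (N0 := N0.+1) (C := 4 * C)) => -[//|N] hN.
  have -> : f x = (\sum_(n < N.+1) T true n) x + (\sum_(n < N.+1) T false n) x.
    rewrite -(hN0 N hN) -tsum !section_sum -big_split /=.
    apply: eq_bigr => n _; rewrite /T.
    by case: (odd n); rewrite section0 ?addr0 ?add0r.
  rewrite sectionD opprD addrACA (le_trans (ler_normD _ _))//.
  have -> : 4 * C * 2^-1 ^+ N.+1
      = 2 * C * 2^-1 ^+ N.+1 + 2 * C * 2^-1 ^+ N.+1 by ring.
  by rewrite lerD// distrC.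
have [p ap] : exists p, theta (a p) y != 0.
  have [h|] := eqVneq (theta (a true) y) 0; last by exists true.
  by exists false; move: fy; rewrite fE linearD sectionD h add0r.
have [k x Tk|k x Tk|x|k] := separating_disjoint_sum (t := T p) (a' := a' p) _ _ _ ap.
- apply: (aE _ _ _ k.+1) => N kN; rewrite section_sum (bigD1 (Ordinal kN))//=.
  rewrite big1 ?addr0// => n nk; apply: T_other Tk _.
  by apply: contraNneq nk => nk; apply/eqP/val_inj.
- apply: (aE' _ _ _ k.+1) => N kN; rewrite section_sum (bigD1 (Ordinal kN))//.
  rewrite big1 => [|n nk]; first exact: addr0.
  by rewrite sectionZ (T_other _ _ _ _ Tk) ?scaler0.
- apply: contraNP => nk; apply/eqP/(aE _ _ _ 0%N) => N _.
  rewrite section_sum big1// => n _; apply/eqP/negPn/negP => h; apply: nk.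
  by exists n.
rewrite /T; case: ifP => [_ tk|_]; last by rewrite linear0 section0 eqxx.
exists (4 ^+ k)^-1, (t k); split=> // x xk.
by apply: t_small; rewrite -ler_pdivlMl ?exprn_gt0// mulr1.
Qed.

Lemma separating_support y : exists x, forall f : section_space E,
  f x = 0 -> theta f y = 0.
Proof.
apply: contrapT => nx.
have bad x : exists2 f : section_space E, f x = 0 & theta f y != 0.
  apply: contrapT => h; apply: nx; exists x => f fx.
  by apply/eqP/negPn/negP => fy; apply: h; exists f.
have [v v0] := fiber_nonzero F y.
have [g gF gv] := sections_full v.
pose f0 := theta_inv (Section gF).
have f0y : theta f0 y != 0 by rewrite theta_invK /section_at /= gv.
have [r [h [r0 hr hy]]] := separating_truncate f0y.
have [C cC Cf] := norm_section_vanishes (section_valP f0) r0.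
(* Multiplying by [phi] kills a section on [A] but keeps its image nonzero at [y]; products of such
   cutoffs deal with unions. *)
pose Q (A : set Omega) := exists phi : Omega -> K, [/\ continuous phi,
  forall x, `|phi x| <= 1, forall x, A x -> phi x = 0 &
  forall g g' : section_space E, (forall x, g' x = phi x *: g x) ->
    theta g y != 0 -> theta g' y != 0].
have [phi [_ _ phiC phiy]] : Q C.
  apply: compact_ind cC _ _ _ _.
  - exists (fun=> 1); split=> // [x|x|k k' kk'].
    + exact: cvg_cst.
    + by rewrite normr1.
    + suff -> : k' = k by [].
      by apply: section_ext => x; rewrite kk' scale1r.
  - move=> A B AB [phi [? ? B0 ?]]; exists phi; split=> // x /AB; exact: B0.
  - move=> A B [p [cp p1 pA py]] [q [cq q1 qB qy]].
    exists (fun x => p x * q x); split=> [x|x|x|k k' kk' ky].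
    + by apply: cvgM; [exact: cp|exact: cq].
    + by rewrite normrM mulr_ile1.
    + by case=> [/pA|/qB] ->; rewrite ?mul0r ?mulr0.
    + have [l lE] := section_scaleE k cq q1.
      by apply: (py l) (qy k l lE ky) => x; rewrite kk' lE scalerA.
  - move=> x _; have [f fx fy] := bad x.
    have [s [l [s0 ls ly]]] := separating_truncate fy.
    (* [psi] is 1 where [|f| >= s] and 0 where [|f| <= s / 2], which includes a neighbourhood of
       [x]. *)
    pose psi z := clamp (2 / s * `|f z| - 1).
    have ur z : 2 / s * `|f z| - 1 \is Num.real.
      by rewrite realB// ger0_real// mulr_ge0// divr_ge0 ?ltW.
    have s2 : 0 < s / 2 by rewrite divr_gt0.
    exists [set z | `|f z| <= s / 2].
      have /cvgrPdist_lt /(_ _ s2) := @section_norm_continuous _ _ E f x.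
      by apply: filterS => z /=; rewrite fx normr0 sub0r normrN normr_id => /ltW.
    exists psi; split=> [z|z|z zs|k k' kk' ky].
    + apply: continuous_clamp => {}z; apply: cvgB; last exact: cvg_cst.
      by apply: cvgM; [exact: cvg_cst|exact: section_norm_continuous].
    + exact: norm_clamp_le1.
    + rewrite /psi clamp_eq0// subr_le0.
      rewrite (@le_trans _ _ (2 / s * (s / 2)))//.
        by rewrite ler_wpM2l// divr_ge0// ltW.
      by rewrite mulrA divfK ?gt_eqF// divff.
    (* [l] lives where [|f| > s], hence where [psi] is 1 and [k - k'] vanishes, and [theta l y] is
       nonzero. *)
    + have : theta (k - k') y = 0.
        apply: separating_eq0 ly => z; apply: contraNeq => lz.
        rewrite sectionB kk' /psi clamp_eq1 ?scale1r ?subrr//.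
        have [/ls lz0|sf] := real_leP (normr_real (f z)) (gtr0_real s0).
          by rewrite lz0 eqxx in lz.
        rewrite lerBrDr (@le_trans _ _ (2 / s * s))//.
          by rewrite divfK ?gt_eqF.
        by rewrite ler_wpM2l ?divr_ge0 ?ltW.
      rewrite linearB sectionB => /eqP; rewrite subr_eq0 => /eqP <-//.
(* On [C] the cutoff vanishes; off [C], [|f0| < r], so [h] does. *)
have h0 x : (0 : section_space E) x = phi x *: h x.
  have [/phiC ->|/Cf] := pselect (C x); first by rewrite scale0r.
  by rewrite normr_id => /ltW /hr ->; rewrite scaler0.
by have := phiy h 0 h0 hy; rewrite linear0 section0 eqxx.
Qed.

End Separating.

(** * The supremum norm *)

Section SupNorm.
Variables (K : numFieldType) (K_scalars : real_or_complex K).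
Variables (T : topologicalType) (E : continuous_field K T).

(** The point [x] makes the range nonempty; over an empty space [sup_norm] has its default value
    0. *)
Lemma sup_normP (f : section_space E) (x : T) :
  supremums (range (fun x => `|f x| : K)) (sup_norm f).
Proof.
have rne : range (fun x => `|f x| : K) !=set0 by exists `|f x|; exists x.
have [n fn] := section_bounded K_scalars f.
rewrite /sup_norm /supremum; case: ifPn => [/eqP r0|_].
  by move: rne; rewrite r0 => -[].
apply: xgetPex; apply: (scalar_supremums K_scalars (M := n%:R) rne).
  by move=> _ [y _ <-] /=.
by move=> _ [y _ <-]; exact: fn.
Qed.

Lemma le_sup_norm (f : section_space E) x : `|f x| <= sup_norm f.
Proof. by have [ub _] := sup_normP f x; apply: ub; exists x. Qed.

Lemma sup_norm_empty (f : section_space E) : ~ ([set: T] !=set0) ->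
  sup_norm f = 0.
Proof.
move=> nT; have r0 : range (fun x => `|f x| : K) = set0.
  by rewrite -subset0 => z [y _ _]; apply: nT; exists y.
by rewrite /sup_norm r0 supremum0.
Qed.

Lemma sup_norm_le (f : section_space E) (c : K) : 0 <= c ->
  (forall x, `|f x| <= c) -> sup_norm f <= c.
Proof.
move=> c0 fc; have [[x _]|nT] := pselect ([set: T] !=set0).
  have [_ lb] := sup_normP f x; apply: lb => _ [y _ <-]; exact: fc.
by rewrite sup_norm_empty.
Qed.

Lemma sup_norm_ge0 (f : section_space E) : 0 <= sup_norm f.
Proof.
have [[x _]|nT] := pselect ([set: T] !=set0).
  exact: le_trans (le_sup_norm f x).
by rewrite sup_norm_empty.
Qed.

End SupNorm.

(** * Support maps as mutually inverse homeomorphisms *)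

Lemma section_neq0 (K : numFieldType) (T : topologicalType)
  (E : continuous_field K T) x : exists f : section_space E, f x != 0.
Proof.
have [v v0] := fiber_nonzero E x.
by have [f fE fx] := sections_full v; exists (Section fE); rewrite /section_at/= fx.
Qed.

Section Support.
Variables (K : numFieldType) (K_scalars : real_or_complex K).
Variables (Omega Delta : topologicalType).
Variables (E : continuous_field K Omega) (F : continuous_field K Delta).
Variables (theta : section_space E -> section_space F).
Variables (theta_inv : section_space F -> section_space E).
Variables (sigma : Delta -> Omega) (tau : Omega -> Delta).
Hypothesis sigmaP : forall y (f : section_space E),
  f (sigma y) = 0 -> theta f y = 0.
Hypothesis tauP : forall x (g : section_space F),
  g (tau x) = 0 -> theta_inv g x = 0.

(** Otherwise some [h] is nonzero at [y] and zero at [tau (sigma y)]. Then [theta_inv h] vanishes at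
    [sigma y], so [h = theta (theta_inv h)] vanishes at [y]. *)
Lemma support_cancel :
  hausdorff_space Delta -> locally_compact [set: Delta] ->
  cancel theta_inv theta -> cancel sigma tau.
Proof.
move=> hD lD theta_invK y; apply: contrapT => ne.
have [g gy] := section_neq0 F y.
have U : nbhs y (~` [set tau (sigma y)]).
  apply: open_nbhs_nbhs; split=> [|/esym//].
  apply: closed_openC; exact: accessible_closed_set1 (hausdorff_accessible hD) _.
have [h [hy h0 _]] := section_localize K_scalars hD lD g U.
have : theta (theta_inv h) y = 0 by apply/sigmaP/tauP/h0 => /(_ erefl).
by rewrite theta_invK hy => /eqP; rewrite (negPf gy).
Qed.

(** Take [g] supported in [U] with [g (sigma y) != 0]. Then [theta g] is nonzero at [y], hence near
    [y], and wherever [theta g z != 0] the point [sigma z] lies in [U]. *)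
Lemma support_continuous :
  hausdorff_space Omega -> locally_compact [set: Omega] ->
  cancel theta theta_inv -> cancel sigma tau -> continuous sigma.
Proof.
move=> hO lO thetaK sigmaK y U yU.
have [f fy] := section_neq0 E (sigma y).
have [g [gy g0 _]] := section_localize K_scalars hO lO f yU.
have : theta g y != 0.
  move: fy; rewrite -gy; apply: contra_neq => gy0.
  by rewrite -[X in section_at X]thetaK; apply: tauP; rewrite sigmaK.
move=> /section_neq0_nbhs; apply: filterS => z; apply: contra_neqP => Uz.
by apply/sigmaP/g0.
Qed.

End Support.

(** * Linear maps between fibers *)

Section FiberMaps.
Variables (K : numFieldType) (Omega Delta : topologicalType).
Variables (E : continuous_field K Omega) (F : continuous_field K Delta).
Variables (theta : {linear section_space E -> section_space F}).

(** [H v] is the value at [y] of the image of any section through [v]; the hypothesis makes it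
    independent of that section. *)
Lemma fiber_map (x : Omega) (y : Delta) :
  (forall f : section_space E, f x = 0 -> theta f y = 0) ->
  exists H : {linear fiber E x -> fiber F y},
    forall f : section_space E, theta f y = H (f x).
Proof.
move=> xy.
have /choice[l lE] : forall v, exists f : section_space E, f x = v.
  by move=> v; have [f fE fx] := sections_full v; exists (Section fE).
pose H v := theta (l v) y.
have HE f : theta f y = H (f x).
  apply/eqP; rewrite -subr_eq0 -sectionB -linearB; apply/eqP/xy.
  by rewrite sectionB lE subrr.
have Hlin : linear H.
  move=> a v w; rewrite -{1}[v]lE -{1}[w]lE -sectionZ -sectionD -HE.
  by rewrite linearP.
pose L : {linear fiber E x -> fiber F y} :=
  HB.pack H (GRing.isLinear.Build K _ _ _ H Hlin).
by exists L.
Qed.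

End FiberMaps.

(** * A uniform bound outside a finite set *)

Section UniformBound.
Variables (K : numFieldType) (K_scalars : real_or_complex K).
Variables (Omega Delta : topologicalType).
Hypothesis Omega_hausdorff : hausdorff_space Omega.
Hypothesis Omega_lc : locally_compact [set: Omega].
Variables (E : continuous_field K Omega) (F : continuous_field K Delta).
Variables (theta : section_space E -> section_space F).
Variables (sigma : Delta -> Omega).
Variable H : forall y, {linear fiber E (sigma y) -> fiber F y}.
Hypothesis sigma_inj : injective sigma.
Hypothesis thetaE : forall f y, theta f y = H y (f (sigma y)).

(** Every [y] with [H y] unbounded belongs to all of these sets. *)
Let large (M : nat) := [set y | exists v, M%:R * `|v| < `|H y v|].

(** One hump: [P] lists the points already used, [g] is the sum of the earlier humps, and the new
    hump must not disturb the values over [P]. *)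
Lemma gliding_hump_step (n : nat) (g : section_space E) (P : seq Delta) :
  infinite_set (large (n * 2 ^ n)) ->
  exists yf : Delta * section_space E, [/\
    forall p, p \in P -> yf.2 (sigma p) = 0,
    forall x, `|yf.2 x| <= 2 * 2^-1 ^+ n &
    n%:R <= `|H yf.1 ((g + yf.2) (sigma yf.1))|].
Proof.
move=> linf.
have [y [v yv] yP] : exists2 y, large (n * 2 ^ n) y & y \notin P.
  apply: contrapT => h; apply: linf; apply: (sub_finite_set _ (finite_seq P)).
  by move=> y ly; apply: contrapT => /= /negP yP; apply: h; exists y.
have v0 : 0 < `|v|.
  rewrite normr_gt0; apply: contraTneq yv => ->.
  by rewrite linear0 !normr0 mulr0 ltxx.
(* With norm [2^-1 ^+ n], the factor [n * 2 ^ n] leaves [|H y u| > n]. *)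
pose u := (2^-1 ^+ n / `|v|) *: v.
have un : `|u| = 2^-1 ^+ n.
  rewrite normrZ ger0_norm ?divr_ge0 ?exprn_ge0 ?invr_ge0//.
  by rewrite divfK ?gt_eqF.
have Hu : n%:R < `|H y u|.
  rewrite linearZ normrZ ger0_norm ?divr_ge0 ?exprn_ge0 ?invr_ge0//.
  rewrite mulrAC ltr_pdivlMr// exprVn ltr_pdivlMl ?exprn_gt0//.
  by rewrite mulrA -natrX -natrM [(2 ^ n * n)%N]mulnC.
have [f fE fy] := sections_full u; pose f0 := Section fE.
have f0y : f0 (sigma y) = u := fy.
have U1 : \forall x \near sigma y, `|f0 x| <= 2 * 2^-1 ^+ n.
  have e0 : (0 : K) < 2^-1 ^+ n by rewrite exprn_gt0// invr_gt0.
  have /cvgrPdist_lt /(_ _ e0) := @section_norm_continuous _ _ E f0 (sigma y).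
  apply: filterS => x; rewrite f0y un => h.
  rewrite mulr2n mulrDl mul1r -lerBlDl ltW// (le_lt_trans _ h)//.
  by rewrite distrC real_ler_norm// realB// ger0_real ?exprn_ge0 ?invr_ge0.
have U2 : nbhs (sigma y) (~` [set sigma p | p in [set` P]]).
  apply: open_nbhs_nbhs; split; last first.
    by move=> [p /= pP /sigma_inj py]; rewrite -py pP in yP.
  apply: closed_openC.
  apply: (iffLR accessible_finite_set_closed (hausdorff_accessible _)) => //.
  by apply: finite_image; exact: finite_seq.
have [h [hy h0 hf]] := section_localize K_scalars Omega_hausdorff Omega_lc f0
  (filterI U1 U2).
have hP p : p \in P -> h (sigma p) = 0.
  by move=> pP; apply: h0 => -[_]; apply; exists p.
have hle x : `|h x| <= 2 * 2^-1 ^+ n.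
  have [[Ux _]|Ux] := pselect (((fun x => `|f0 x| <= 2 * 2^-1 ^+ n)
       `&` ~` [set sigma p | p in [set` P]]) x).
    exact: le_trans (hf _) Ux.
  by rewrite h0// normr0 mulr_ge0 ?exprn_ge0 ?invr_ge0.
have real_n : (n%:R : K) \is Num.real by rewrite realn.
have gh : (g + h) (sigma y) = g (sigma y) + u by rewrite sectionD hy f0y.
have gh' : (g + - h) (sigma y) = g (sigma y) - u by rewrite sectionB hy f0y.
(* The images of [g + h] and [g - h] differ by [2 * H y u], so one is large. *)
have [le1|lt1] := real_leP real_n (normr_real (H y (g (sigma y) + u))).
  by exists (y, h); split=> //; rewrite gh.
exists (y, - h); split=> [p pP|x|].
- by rewrite -[LHS]/(- h (sigma p)) hP ?oppr0.
- by rewrite -[X in `|X|]/(- h x) normrN.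
rewrite gh' real_leNgt//; apply/negP => lt2.
have := ltrD lt1 lt2; apply/negP; rewrite -real_leNgt ?realD//.
rewrite (le_trans _ (ler_normB _ _))// -linearB/=.
rewrite [X in H y X](_ : _ = u + u); last first.
  by rewrite opprB addrC addrA subrK.
by rewrite linearD -[X in `|X|]mulr2n normrMn [leRHS]mulr2n lerD ?ltW.
Qed.

(** Otherwise the humps can be chosen one after another and summed to a section [w]. At the [n]-th
    point the later humps vanish, so [|theta w|] is at least [n] there, although [theta w] is
    bounded. *)
Lemma finite_large : exists M, finite_set (large M).
Proof.
apply: contrapT => inf.
have /choice[st0 st0P] : forall ngP : nat * section_space E * seq Delta,
    exists yf : Delta * section_space E, [/\
    forall p, p \in ngP.2 -> yf.2 (sigma p) = 0,
    forall x, `|yf.2 x| <= 2 * 2^-1 ^+ ngP.1.1 &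
    ngP.1.1%:R <= `|H yf.1 ((ngP.1.2 + yf.2) (sigma yf.1))|].
  move=> [[n g] P]; apply: gliding_hump_step => fin; apply: inf.
  by exists (n * 2 ^ n)%N.
(* The state holds the sum of the first [n] humps and their points. *)
pose state := fix state n : section_space E * seq Delta :=
  if n is m.+1 then
    let yf := st0 (m, (state m).1, (state m).2) in
    ((state m).1 + yf.2, yf.1 :: (state m).2)
  else (0, [::]).
pose yf n := st0 (n, (state n).1, (state n).2).
have yfP n := st0P (n, (state n).1, (state n).2).
have stateE n : (state n).1 = \sum_(i < n) (yf i).2.
  by elim: n => [|n IHn]; rewrite ?big_ord0// big_ord_recr /= -IHn.
have visited n m : (n < m)%N -> (yf n).1 \in (state m).2.
  elim: m => // m IHm; rewrite ltnS leq_eqVlt => /predU1P[->|/IHm] /=.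
    exact: mem_head.
  by rewrite inE => ->; rewrite orbT.
have fle n x : `|(yf n).2 x| <= 2 * 2^-1 ^+ n by have [_ + _] := yfP n; exact.
have [w wP] := section_series K_scalars fle.
have wE n : w (sigma (yf n).1) = (state n.+1).1 (sigma (yf n).1).
  apply: (eq_of_dist_exp_half K_scalars (N0 := n.+1) (C := 2 * 2)) => N nN.
  suff -> : (state n.+1).1 (sigma (yf n).1) = (state N).1 (sigma (yf n).1).
    by rewrite stateE; exact: wP.
  elim: N nN => // N IHN; rewrite leq_eqVlt => /predU1P[[->]//|nN].
  rewrite IHN// [(state N.+1).1](_ : _ = (state N).1 + (yf N).2)// sectionD.
  have [f0 _ _] := yfP N.
  by rewrite [X in _ + X](f0 _ (visited _ _ (nN : (n < N)%N))) addr0.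
have [m mP] := section_bounded K_scalars (theta w).
have := mP (yf m.+1).1; rewrite thetaE wE.
have [_ _] := yfP m.+1 => /= h1 h2.
by have := le_trans h1 h2; rewrite ler_nat ltnn.
Qed.

End UniformBound.

(** * Isolated points and the conclusion *)

Lemma isolated_of_finite_nbhs (T : topologicalType) (x : T) (A : set T) :
  accessible_space T -> nbhs x A -> finite_set A -> isolated [set: T] x.
Proof.
move=> aT xA fA; split; first by rewrite in_setT.
exists (A `&` ~` (A `\ x)).
  apply: filterI => //; apply: open_nbhs_nbhs; split; last by case=> _; apply.
  apply: closed_openC; apply: (iffLR accessible_finite_set_closed aT).
  exact: finite_setD.
rewrite setIT; apply/seteqP; split=> [y [Ay yx]|y ->] /=.
  by apply: contrapT => nyx; apply: yx.
by split; [exact: nbhs_singleton|case=> _; apply].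
Qed.

Lemma homeomorphism_isolated (S T : topologicalType) (sigma : S -> T) y :
  homeomorphism sigma -> isolated [set: S] y -> isolated [set: T] (sigma y).
Proof.
move=> [_ [tau [sK tK ctau]]] [_ [V yV]]; rewrite setIT => VE.
split; first by rewrite in_setT.
exists (tau @^-1` V); first by apply: ctau; rewrite sK.
rewrite setIT VE; apply/seteqP; split=> x /=; first by move=> <-; rewrite tK.
by move=> ->; rewrite sK.
Qed.

Theorem theorem5p4 (K : numFieldType) (K_scalars : real_or_complex K)
  (Omega Delta : topologicalType)
  (Omega_hausdorff : hausdorff_space Omega)
  (Omega_lc : locally_compact [set: Omega])
  (Delta_hausdorff : hausdorff_space Delta)
  (Delta_lc : locally_compact [set: Delta])
  (E : continuous_field K Omega) (F : continuous_field K Delta)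
  (theta : {linear section_space E -> section_space F})
  (theta_inv : section_space F -> section_space E)
  (thetaK : cancel theta theta_inv) (theta_invK : cancel theta_inv theta)
  (theta_sep : separating theta) (theta_inv_sep : separating theta_inv) :
  (exists (sigma : Delta -> Omega)
          (H : forall nu : Delta,
               {linear fiber E (sigma nu) -> fiber F nu}),
     [/\ homeomorphism sigma,
         forall nu, bijective (H nu),
         forall (f : section_space E) (nu : Delta),
           theta f nu = H nu (f (sigma nu)),
         finite_set [set nu | ~ bounded_operator (H nu)] &
         forall nu, ~ bounded_operator (H nu) -> isolated [set: Delta] nu])
  /\
  ((forall x, ~ isolated [set: Omega] x) \/
   (forall y, ~ isolated [set: Delta] y) ->
   bounded_wrt (@sup_norm _ _ E) (@sup_norm _ _ F) theta).
Proof.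
(* The inverse is packed as a linear map so that the support lemma applies with the roles
   exchanged. *)
pose L : {linear section_space F -> section_space E} :=
  HB.pack theta_inv (GRing.isLinear.Build K _ _ _ theta_inv
    (can2_linear thetaK theta_invK)).
have L_theta : cancel theta L := thetaK.
have theta_L : cancel L theta := theta_invK.
have L_sep : separating L := theta_inv_sep.
have /choice[sigma sigmaP] := separating_support K_scalars Delta_hausdorff
  Delta_lc thetaK theta_invK theta_sep theta_inv_sep.
have /choice[tau tauP] := separating_support K_scalars Omega_hausdorff
  Omega_lc theta_L L_theta L_sep theta_sep.
have sigmaK : cancel sigma tau.
  exact: (support_cancel K_scalars sigmaP tauP).
have tauK : cancel tau sigma.
  exact: (support_cancel K_scalars tauP sigmaP).
have homeo : homeomorphism sigma.
  split; last exists tau; last split=> //.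
    exact: (support_continuous K_scalars sigmaP tauP).
  exact: (support_continuous K_scalars tauP sigmaP).
have Hex y := cid (fiber_map (sigmaP y)).
pose H y : {linear fiber E (sigma y) -> fiber F y} := projT1 (Hex y).
have HE f y : theta f y = H y (f (sigma y)) := projT2 (Hex y) f.
have bijH y : bijective (H y).
  (* If [H y v = 0] and [f] passes through [v], then [theta f] vanishes at [y = tau (sigma y)], so
     [f] vanishes at [sigma y]. *)
  have injH : injective (H y).
    apply: raddf_inj => v Hv.
    have [f fE fv] := sections_full v.
    rewrite -fv -[LHS]/(Section fE (sigma y)) -[Section fE]thetaK.
    by apply: tauP; rewrite sigmaK HE -Hv; congr (H y _).
  have /choice[g gK] : forall w, exists v, H y v = w.
    move=> w; have [g gF gw] := sections_full w.
    by exists (theta_inv (Section gF) (sigma y)); rewrite -HE theta_invK.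
  by exists g => // v; apply: injH.
have [M finM] := finite_large K_scalars Omega_hausdorff Omega_lc
  (can_inj sigmaK) HE.
have real_M (a : K) : 0 <= a -> M%:R * a \is Num.real.
  by move=> a0; rewrite ger0_real ?mulr_ge0.
have bounded_M y v : ~ (exists v, M%:R * `|v| < `|H y v|) ->
    `|H y v| <= M%:R * `|v|.
  move=> h; rewrite real_leNgt ?real_M//; apply/negP => lt.
  by apply: h; exists v.
(* Extended to a section through [v], the strict inequality persists near [y], so a whole
   neighbourhood of [y] lies in a finite set. *)
have isoM y : (exists v, M%:R * `|v| < `|H y v|) -> isolated [set: Delta] y.
  move=> [v vy]; have [f0 fE fv] := sections_full v; pose f := Section fE.
  have fy : f (sigma y) = v := fv.
  apply: (isolated_of_finite_nbhs (hausdorff_accessible Delta_hausdorff) _ finM).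
  have d0 : 0 < `|theta f y| - M%:R * `|f (sigma y)|.
    by rewrite subr_gt0 HE fy.
  have cd : (fun z => `|theta f z| - M%:R * `|f (sigma z)| : K) @ y
      --> `|theta f y| - M%:R * `|f (sigma y)|.
    apply: cvgB; first exact: section_norm_continuous.
    apply: cvgM; first exact: cvg_cst.
    apply: (cvg_comp sigma (fun x => `|f x| : K)); first exact: homeo.1.
    exact: section_norm_continuous.
  move/cvgrPdist_lt: cd => /(_ _ d0); apply: filterS => z h.
  exists (f (sigma z)); rewrite -HE -subr_gt0.
  have := le_lt_trans (real_ler_norm _) h.
  by rewrite ltrBlDr ltrDl => -> //; rewrite !realB ?real_M.
split.
  exists sigma, H; split=> //.
  - apply: sub_finite_set finM => y nb; apply: contrapT => h; apply: nb.
    by exists M%:R => v; exact: bounded_M.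
  - move=> y nb; apply: isoM; apply: contrapT => h; apply: nb.
    by exists M%:R => v; exact: bounded_M.
move=> no_iso.
have no_isoD y : ~ isolated [set: Delta] y.
  case: no_iso => // nO iy; exact: nO _ (homeomorphism_isolated homeo iy).
(* Without isolated points the exceptional set is empty, so [M] bounds every fiber map. *)
exists M%:R => f.
apply: (sup_norm_le K_scalars) => [|y].
  by rewrite mulr_ge0// sup_norm_ge0.
rewrite HE (le_trans (bounded_M _ _ _))//; first by move=> /isoM /no_isoD.
by rewrite ler_wpM2l// le_sup_norm.
Qed.
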